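(* Suppose that $\Pi$ is the Gaussian law $N(\mu,\gamma^2)$ with $\mu\in\mathbb R$, $\gamma>0$. Let $$\lambda^*=\frac{-c+\sqrt{c^2+4\frac{\gamma^2}{\sigma^2}}}{2},$$ which is the positive root of $\sigma^2\lambda^2+\hat c\lambda-\gamma^2=0$, and let $\phi^*(y)=\frac{\lambda^*y^2}{2}+\mu y$ for $y\in\mathbb R$. Then $T_0\phi^*=\phi^*$. Moreover, for all $v\in\mathbb R$, $$\Psi^*(v):=\hat c\log T_1(\phi^* )(v)=\frac{\hat c}{2}\log\frac{c}{c+\lambda^*}+\frac{(\mu-v)^2}{2(c+\lambda^* )}.$$
   Context: Fix constants $c>0$, $\sigma>0$ and put $\hat c:=c\sigma^2$. $\Pi$ is the law of a real random variable $V$, with support $\mathcal V$ (here $\mathcal V=\mathbb R$). For measurable $\phi:\mathbb R\to\mathbb R$ and $\Psi:\mathcal V\to\mathbb R$ define $$T_1(\phi)(v):=\int_{\mathbb R}\exp\Big(\frac{yv-\phi(y)}{\hat c}\Big)\frac{1}{\sqrt{2\pi\sigma^2}}\exp\Big(-\frac{y^2}{2\sigma^2}\Big)dy,\quad v\in\mathcal V,$$ $$T_2(\Psi)(y):=\int_{\mathcal V}\exp\Big(\frac{yv-\Psi(v)}{\hat c}\Big)\Pi(dv),\quad y\in\mathbb R.$$ For $\phi$ such that $T_1(\phi)$ takes values in $(0,\infty)$ and, with $\Psi:=\hat c\log T_1(\phi)$, $T_2(\Psi)$ takes values in $(0,\infty)$, define $T_0\phi(y):=\hat c\log T_2(\Psi)(y)$,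 $y\in\mathbb R$. *)

(* Defs.v *)
From HB Require Import structures.
From mathcomp Require Import all_boot all_order all_algebra.
From mathcomp Require Import all_classical all_reals all_analysis.

Set Implicit Arguments.
Unset Strict Implicit.
Unset Printing Implicit Defensive.

Import Order.TTheory GRing.Theory Num.Theory.
Import numFieldNormedType.Exports.

Local Open Scope classical_set_scope.
Local Open Scope ring_scope.

Definition chat (R : realType) (c sigma : R) : R := c * sigma ^+ 2.

(* The integrands below are nonnegative, so the extended-real integrals are
   meaningful whether or not they are finite. *)
Definition T1 (R : realType) (c sigma : R) (phi : R -> R) (v : R) : \bar R :=
  (\int[lebesgue_measure]_y
     (expR ((y * v - phi y) / chat c sigma)
      * ((Num.sqrt (2 * pi * sigma ^+ 2))^-1
         * expR (- (y ^+ 2 / (2 * sigma ^+ 2)))))%:E)%E.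

(* Pi is a law with full support, so Psi is defined on all of R. *)
Definition T2 (R : realType) (c sigma : R)
    (Pi : probability (measurableTypeR R) R) (Psi : R -> R) (y : R) : \bar R :=
  (\int[Pi]_v (expR ((y * v - Psi v) / chat c sigma))%:E)%E.

(* fine maps infinities to 0 and ln maps nonpositive reals to 0, so logT1 and T0
   have their intended meaning only under T0_defined. *)
Definition logT1 (R : realType) (c sigma : R) (phi : R -> R) (v : R) : R :=
  chat c sigma * ln (fine (T1 c sigma phi v)).

Definition T0_defined (R : realType) (c sigma : R)
    (Pi : probability (measurableTypeR R) R) (phi : R -> R) : Prop :=
  [/\ measurable_fun [set: R] phi,
      forall v : R, (0 < T1 c sigma phi v < +oo)%E
    & forall y : R, (0 < T2 c sigma Pi (logT1 c sigma phi) y < +oo)%E].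

Definition T0 (R : realType) (c sigma : R)
    (Pi : probability (measurableTypeR R) R) (phi : R -> R) (y : R) : R :=
  chat c sigma * ln (fine (T2 c sigma Pi (logT1 c sigma phi) y)).

Definition lambda_star (R : realType) (c sigma gamma : R) : R :=
  (- c + Num.sqrt (c ^+ 2 + 4 * (gamma ^+ 2 / sigma ^+ 2))) / 2.

Definition phi_star (R : realType) (c sigma mu gamma : R) (y : R) : R :=
  lambda_star c sigma gamma * y ^+ 2 / 2 + mu * y.

(* Main.v *)
(** Completing the square shows that [T1] and [T2] send exponentials of quadratics
    to exponentials of quadratics. [T1 phi_star] is a Gaussian integral with
    variance [chat / (c + lambda)]. In [T2], the quadratic part of [Psi] adds
    [1 / (chat * (c + lambda))] to the precision [1 / gamma ^+ 2]; since
    [gamma ^+ 2 = sigma ^+ 2 * lambda * (c + lambda)], the total precision is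
    [1 / (chat * lambda)], which reproduces [phi_star], and the two normalizing
    factors are [sqrt (c / (c + lambda))] and its inverse. *)
Require Import Defs.
From HB Require Import structures.
From mathcomp Require Import all_boot all_order all_algebra.
From mathcomp Require Import all_classical all_reals all_analysis.
From mathcomp Require Import measurable_realfun ring lra.
Import Order.TTheory GRing.Theory Num.Theory.
Import numFieldNormedType.Exports.
Local Open Scope classical_set_scope.
Local Open Scope ring_scope.

(** Change of variables gives this with the Radon-Nikodym derivative as weight; that derivative
    equals [normal_pdf] almost everywhere, since both integrate to [normal_prob m s E] over every
    measurable [E]. *)
Lemma ge0_integral_normal_prob (R : realType) (m s : R)
    (f : R -> \bar R) :
  measurable_fun [set: R] f -> (forall x, 0 <= f x)%E ->
  (\int[normal_prob m s]_x f x
   = \int[lebesgue_measure]_x (f x * (normal_pdf m s x)%:E))%E.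
Proof.
move=> mf f0; have dom := @normal_prob_dominates R m s.
have mpdf : measurable_fun setT (fun x => (normal_pdf m s x)%:E).
  by apply/measurable_EFinP; exact: measurable_normal_pdf.
rewrite -(@Radon_Nikodym_SigmaFinite.change_of_variables _ _ _ _ _ dom)//.
have iRN := Radon_Nikodym_SigmaFinite.f_integrable dom.
apply: ae_eq_integral => //.
- by apply: emeasurable_funM => //; exact: measurable_int iRN.
- exact: emeasurable_funM.
apply: ae_eqe_mul2l; apply: integral_ae_eq => // E _ mE.
by rewrite -Radon_Nikodym_SigmaFinite.f_integral.
Qed.

(** Moves square-root normalizations into exponents, so that later identities only compare
    exponents. *)
Lemma expR_half_ln (R : realType) (a : R) : 0 < a -> expR (ln a / 2) = Num.sqrt a.
Proof.
move=> a0; rewrite -[in ln a](sqr_sqrtr (ltW a0)) lnXn ?sqrtr_gt0//.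
by rewrite -(mulr_natr (ln _)) mulfK// lnK// posrE sqrtr_gt0.
Qed.

(** The linear term shifts the mean: the integrand is a constant times the normal density with mean
    [m + b * t] and variance [t]. *)
Lemma integral_expR_quadratic (R : realType) (k b m t : R) : 0 < t ->
  (\int[lebesgue_measure]_x
     (expR (k + b * (x - m) - (x - m) ^+ 2 / (2 * t)))%:E
   = (expR (k + b ^+ 2 * t / 2 + ln (2 * pi * t) / 2))%:E)%E.
Proof.
move=> t0; have tE : Num.sqrt t ^+ 2 = t by rewrite sqr_sqrtr ?ltW.
have s0 : Num.sqrt t != 0 by rewrite gt_eqF ?sqrtr_gt0.
have A0 : 0 < 2 * pi * t by rewrite !mulr_gt0 ?pi_gt0.
have peakE : normal_peak (Num.sqrt t) = (Num.sqrt (2 * pi * t))^-1.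
  by rewrite /normal_peak tE; congr (Num.sqrt _)^-1; ring.
rewrite expRD expR_half_ln//.
under eq_integral => x _.
  have -> : expR (k + b * (x - m) - (x - m) ^+ 2 / (2 * t)) =
      expR (k + b ^+ 2 * t / 2) * Num.sqrt (2 * pi * t)
      * normal_pdf (m + b * t) (Num.sqrt t) x.
    rewrite normal_pdfE// peakE /normal_fun tE mulrA mulfK ?gt_eqF ?sqrtr_gt0//.
    by rewrite -expRD; congr expR; field; rewrite gt_eqF.
  rewrite EFinM.
  over.
rewrite integralZl//; last exact: integrable_normal_pdf.
by rewrite integral_normal_pdf mule1.
Qed.

Lemma T1_quadratic (R : realType) (c sigma l m v : R) :
  0 < c -> 0 < sigma -> 0 < c + l ->
  T1 c sigma (fun y => l * y ^+ 2 / 2 + m * y) v =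
  (expR ((chat c sigma / 2 * ln (c / (c + l)) + (m - v) ^+ 2 / (2 * (c + l)))
         / chat c sigma))%:E.
Proof.
move=> c0 s0 cl0; rewrite /T1 /chat.
have [cN sN clN] : [/\ c != 0, sigma != 0 & c + l != 0] by rewrite !gt_eqF.
have A0 : 0 < 2 * pi * sigma ^+ 2 by rewrite !mulr_gt0 ?pi_gt0 ?exprn_gt0.
have t0 : 0 < c * sigma ^+ 2 / (c + l) by rewrite divr_gt0 ?mulr_gt0 ?exprn_gt0.
rewrite -expR_half_ln// -expRN.
under eq_integral => y _.
  rewrite -!expRD (_ : _ + _ = - (ln (2 * pi * sigma ^+ 2) / 2)
    + (v - m) / (c * sigma ^+ 2) * (y - 0)
    - (y - 0) ^+ 2 / (2 * (c * sigma ^+ 2 / (c + l)))); last first.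
    by field; rewrite ?cN ?sN ?clN.
  over.
rewrite integral_expR_quadratic//; congr (expR _)%:E.
(* Splitting off [c / (c + l)] lets the remaining logarithm cancel the one from the Gaussian
   prefactor. *)
rewrite (_ : 2 * pi * (c * sigma ^+ 2 / (c + l))
  = 2 * pi * sigma ^+ 2 * (c / (c + l))); last by field.
rewrite (lnM (y := c / _)) ?posrE ?divr_gt0//.
by field; rewrite ?cN ?sN ?clN.
Qed.

Lemma T2_normal_quadratic (R : realType) (c sigma gamma l m y : R) :
  0 < c -> 0 < sigma -> 0 < gamma -> 0 < l ->
  sigma ^+ 2 * l ^+ 2 + chat c sigma * l - gamma ^+ 2 = 0 ->
  T2 c sigma (normal_prob m gamma)
    (fun v => chat c sigma / 2 * ln (c / (c + l)) + (m - v) ^+ 2 / (2 * (c + l))) y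
  = (expR ((l * y ^+ 2 / 2 + m * y) / chat c sigma))%:E.
Proof.
rewrite /T2 /chat => c0 s0 g0 l0 root.
have cl0 : 0 < c + l by rewrite addr_gt0.
have gE : gamma ^+ 2 = sigma ^+ 2 * l * (c + l).
  by apply/esym/eqP; rewrite -subr_eq0 -root; apply/eqP; ring.
have [cN sN clN lN] : [/\ c != 0, sigma != 0, c + l != 0 & l != 0].
  by rewrite !gt_eqF.
have A0 : 0 < 2 * pi * gamma ^+ 2 by rewrite !mulr_gt0 ?pi_gt0 ?exprn_gt0.
have t0 : 0 < c * sigma ^+ 2 * l by rewrite !mulr_gt0 ?exprn_gt0.
have peakE : normal_peak gamma = expR (- (ln (2 * pi * gamma ^+ 2) / 2)).
  rewrite expRN expR_half_ln// /normal_peak.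
  by congr (Num.sqrt _)^-1; ring.
rewrite ge0_integral_normal_prob; last 2 first.
- apply/measurable_EFinP/measurableT_comp => //; apply: measurable_funM => //.
  apply: measurable_funB; first exact: measurable_funM.
  apply: measurable_funD => //; apply: measurable_funM => //.
  by apply: measurable_funX; exact: measurable_funB.
- by move=> v; rewrite lee_fin expR_ge0.
under eq_integral => v _.
  rewrite -EFinM normal_pdfE ?gt_eqF// peakE /normal_fun -!expRD gE.
  (* [Psi] and the density are both even in [v - m], so the linear term comes from [y * v] alone. *)
  rewrite (_ : _ + (_ + _) = (y * m / (c * sigma ^+ 2) - ln (c / (c + l)) / 2
      - ln (2 * pi * (sigma ^+ 2 * l * (c + l))) / 2)
    + y / (c * sigma ^+ 2) * (v - m)
    - (v - m) ^+ 2 / (2 * (c * sigma ^+ 2 * l))); last first.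
    by field; rewrite ?cN ?sN ?clN ?lN.
  over.
rewrite integral_expR_quadratic//; congr (expR _)%:E.
(* The new variance is [gamma ^+ 2 * (c / (c + l))], so its logarithm cancels those of the density
   and of [Psi]. *)
rewrite (_ : 2 * pi * (c * sigma ^+ 2 * l)
  = 2 * pi * (sigma ^+ 2 * l * (c + l)) * (c / (c + l))); last by field.
rewrite (lnM (y := c / _)) ?posrE ?divr_gt0// -?gE//.
by field; rewrite ?cN ?sN ?clN.
Qed.

Lemma lambda_star_rootP (R : realType) (c sigma gamma : R) :
  0 < c -> 0 < sigma -> 0 < gamma -> forall x : R,
  (0 < x /\ sigma ^+ 2 * x ^+ 2 + chat c sigma * x - gamma ^+ 2 = 0)
  <-> x = lambda_star c sigma gamma.
Proof.
move=> c0 s0 g0 x; rewrite /lambda_star /chat.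
have sN : sigma != 0 by rewrite gt_eqF.
have d0 : 0 < gamma ^+ 2 / sigma ^+ 2 by rewrite divr_gt0 ?exprn_gt0.
have D0 : 0 <= c ^+ 2 + 4 * (gamma ^+ 2 / sigma ^+ 2).
  by rewrite addr_ge0 ?sqr_ge0// mulr_ge0// ltW.
split=> [[x0 root]|->].
(* At a root the discriminant is a perfect square, and [0 < x] fixes the sign of its square root. *)
- have -> : c ^+ 2 + 4 * (gamma ^+ 2 / sigma ^+ 2) = (2 * x + c) ^+ 2.
    rewrite (_ : gamma ^+ 2 = sigma ^+ 2 * x ^+ 2 + c * sigma ^+ 2 * x).
      by field.
    by apply/esym/eqP; rewrite -subr_eq0 root.
  rewrite sqrtr_sqr ger0_norm; first by field.
  by rewrite addr_ge0 ?mulr_ge0 ?ltW.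
set r := Num.sqrt _; have rE : r ^+ 2 = c ^+ 2 + 4 * (gamma ^+ 2 / sigma ^+ 2).
  by rewrite sqr_sqrtr.
split.
- rewrite divr_gt0// addrC subr_gt0 -(@ltr_pXn2r _ 2)// ?nnegrE ?sqrtr_ge0 ?ltW//.
  by rewrite rE; lra.
(* At [(r - c) / 2] the terms linear in [r] cancel, leaving only [r ^+ 2], which is known. *)
- transitivity (sigma ^+ 2 * (r ^+ 2 - c ^+ 2) / 4 - gamma ^+ 2); first by field.
  by rewrite rE; field.
Qed.

Theorem theorem5p2 (R : realType) (c sigma mu gamma : R)
    (hc : 0 < c) (hsigma : 0 < sigma) (hgamma : 0 < gamma) :
  let lambda := lambda_star c sigma gamma in
  let phi := phi_star c sigma mu gamma in
  let Pi : probability (measurableTypeR R) R := normal_prob mu gamma in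
  (forall x : R,
     (0 < x /\ sigma ^+ 2 * x ^+ 2 + chat c sigma * x - gamma ^+ 2 = 0)
     <-> x = lambda)
  /\ T0_defined c sigma Pi phi
  /\ T0 c sigma Pi phi = phi
  /\ (forall v : R,
        logT1 c sigma phi v =
        chat c sigma / 2 * ln (c / (c + lambda))
        + (mu - v) ^+ 2 / (2 * (c + lambda))).
Proof.
move=> lambda phi Pi; have rootP := lambda_star_rootP _ _ _ _ hc hsigma hgamma.
have [l0 root] := (rootP lambda).2 erefl.
have cl0 : 0 < c + lambda by rewrite addr_gt0.
have ch0 : chat c sigma != 0 by rewrite mulf_neq0 ?expf_neq0 ?gt_eqF.
have T1E v := T1_quadratic _ _ _ _ mu v hc hsigma cl0.
have logT1E : logT1 c sigma phi = fun v =>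
    chat c sigma / 2 * ln (c / (c + lambda)) + (mu - v) ^+ 2 / (2 * (c + lambda)).
  (* [T1] is the exponential of a real number, so no default value of [fine] or [ln] intervenes. *)
  by apply/funext => v; rewrite /logT1 T1E/= expRK mulrC divfK.
have T2E y : T2 c sigma Pi (logT1 c sigma phi) y = (expR (phi y / chat c sigma))%:E.
  by rewrite logT1E; exact: T2_normal_quadratic.
split; first exact: rootP.
split; last split.
- split.
  + apply: measurable_funD; last exact: measurable_funM.
    by apply: measurable_funM => //; apply: measurable_funM.
  + by move=> v; rewrite T1E lte_fin expR_gt0 ltry.
  + by move=> y; rewrite T2E lte_fin expR_gt0 ltry.
- by apply/funext => y; rewrite /T0 T2E/= expRK mulrC divfK.
- by move=> v; rewrite logT1E.
Qed.
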